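(* Let $V_1,V_2\in C(\mathbb{T}^n)$ and $H_i(\xi,p)=|p|^2-V_i(\xi)$ for $i=1,2$. Assume that $V_1\equiv0$, $V_2\ge0$, and that there exist an open set $W$ in $\mathbb{T}^n$ and a vector $q\in\mathbb{R}^n$ such that $\Pi(q+W)\Subset(0,1)^n$ and $$\emptyset\neq\{V_2=0\}\subset W.$$ Then there exists $\gamma>0$ such that $\overline{H}(P)=0$ for all $P\in\mathbb{R}^n$ with $|P|\le\gamma$.
   Context: $\mathbb{T}^n=\mathbb{R}^n/\mathbb{Z}^n$ is identified with $[0,1]^n$ (opposite faces glued), $\Pi:\mathbb{R}^n\to\mathbb{T}^n$ is the canonical projection, and subsets of, and functions on, $\mathbb{T}^n$ are identified with their $\mathbb{Z}^n$-periodic extensions to $\mathbb{R}^n$. $A\Subset B$ means that $A$ is compactly contained in $B$. Effective Hamiltonian: for each $P\in\mathbb{R}^n$ it is known that there is a unique constant $\overline{H}(P)$ such that the cell problem $$H_1(\xi,P+Dv_1(\xi))+v_1(\xi)-v_2(\xi)=\overline{H}(P),\qquad H_2(\xi,P+Dv_2(\xi))+v_2(\xi)-v_1(\xi)=\overline{H}(P)\quad\text{in }\mathbb{T}^n$$ admits a continuous viscosity solution $(v_1,v_2)\in C(\mathbb{T}^n)^2$ (viscosity inequalities are imposed on each component with the other component inserted as a given function). *)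

(* Defs.v *)
From HB Require Import structures.
From mathcomp Require Import all_boot all_order all_algebra.
From mathcomp Require Import all_classical all_reals all_analysis.
Set Implicit Arguments.
Unset Strict Implicit.
Unset Printing Implicit Defensive.
Import Order.TTheory GRing.Theory Num.Theory.
Import numFieldNormedType.Exports.
Local Open Scope classical_set_scope.
Local Open Scope ring_scope.

Section Defs.
Variables (R : realType) (n : nat).
Implicit Types (x p q P : 'rV[R]_n) (u v phi V : 'rV[R]_n -> R).

(* The library norm on 'rV[R]_n is the sup norm, hence this definition. *)
Definition enorm p : R := Num.sqrt (\sum_(i < n) p 0 i ^+ 2).

(* Functions on the torus (T arbitrary) and subsets of the torus (T := Prop)
   are represented by their Z^n-periodic extensions to R^n. *)
Definition Zn_periodic (T : Type) (f : 'rV[R]_n -> T) : Prop :=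
  forall x (z : 'rV[int]_n), f (x + map_mx intr z) = f x.

Definition torus_continuous u : Prop := Zn_periodic u /\ continuous u.

Definition torus_open (W : set 'rV[R]_n) : Prop := Zn_periodic W /\ open W.

(* Pi(A) as a subset of [0,1]^n: since opposite faces are glued, every
   representative in [0,1]^n of a class meeting A is included. *)
Definition torus_proj (A : set 'rV[R]_n) : set 'rV[R]_n :=
  [set x : 'rV[R]_n | (forall i, 0 <= x 0 i <= 1) /\
           exists z : 'rV[int]_n, A (x + map_mx intr z)].

Definition open_cube : set 'rV[R]_n := [set x : 'rV[R]_n | forall i, 0 < x 0 i < 1].

Definition compactly_contained (A B : set 'rV[R]_n) : Prop :=
  compact (closure A) /\ closure A `<=` B.

Definition grad phi x : 'rV[R]_n := \row_i 'D_(delta_mx 0 i) phi x.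

Definition C1 phi : Prop :=
  (forall x, differentiable phi x) /\ continuous (grad phi).

(* Viscosity inequalities for F(x, Du) <= 0 and F(x, Du) >= 0. Any zeroth
   order term is part of F, evaluated at the given functions. *)
Definition visc_subsol (F : 'rV[R]_n -> 'rV[R]_n -> R) u : Prop :=
  forall phi x, C1 phi ->
    (\forall y \near x, u y - phi y <= u x - phi x) -> F x (grad phi x) <= 0.

Definition visc_supersol (F : 'rV[R]_n -> 'rV[R]_n -> R) u : Prop :=
  forall phi x, C1 phi ->
    (\forall y \near x, u x - phi x <= u y - phi y) -> 0 <= F x (grad phi x).

Definition visc_sol (F : 'rV[R]_n -> 'rV[R]_n -> R) u : Prop :=
  visc_subsol F u /\ visc_supersol F u.

Definition cell_solution (H1 H2 : 'rV[R]_n -> 'rV[R]_n -> R) P (c : R)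
    (v1 v2 : 'rV[R]_n -> R) : Prop :=
  [/\ torus_continuous v1, torus_continuous v2,
      visc_sol (fun x p => H1 x (P + p) + v1 x - v2 x - c) v1 &
      visc_sol (fun x p => H2 x (P + p) + v2 x - v1 x - c) v2].

Definition effective_hamiltonian (H1 H2 : 'rV[R]_n -> 'rV[R]_n -> R)
    (Hbar : 'rV[R]_n -> R) : Prop :=
  forall P, unique (fun c => exists v1 v2, cell_solution H1 H2 P c v1 v2)
                   (Hbar P).

Definition mech_hamiltonian V x p : R := enorm p ^+ 2 - V x.

End Defs.

(* Main.v *)
Require Import Defs.
From mathcomp Require Import all_boot all_order all_algebra.
From mathcomp Require Import all_classical all_reals all_analysis.
From mathcomp Require Import ring lra.
Import Order.TTheory GRing.Theory Num.Theory.
Import numFieldNormedType.Exports.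
Local Open Scope classical_set_scope.
Local Open Scope ring_scope.

(* Write c = Hbar P and let (v1, v2) solve the cell problem.  Subsolution tests
   give v1 - v2 <= c and v2 - v1 <= c + V2 everywhere, so c >= 0 where V2 = 0.
   For c <= 0 compare with a classical subsolution (w1, w2) for the constant 0:
   at the minimum over the torus and both components of v_i - w_i, the
   supersolution test of v_i against w_i gives c <= 0.
   After translation by q the zeros of V2 stay away from the walls y_i in Z.
   Let w1 = - sum_i P_i (y_i - B(y_i)), where B smooths the unit jump of a
   sawtooth within distance a of the walls, and w2 = w1 + sum_i P_i^2 beta(y_i)
   with a bump beta >= B'^2 supported there.  Then P + D w1 and w2 - w1 vanish
   away from the walls, while near the walls V2 is bounded below and dominates
   all the terms, which are O(|P|^2). *)

(** * One-variable profiles: a smoothed unit jump and a bump dominating its squared slope *)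

Section Profiles.
Set Implicit Arguments.
Unset Strict Implicit.
Variable R : realType.
Implicit Types (f : R -> R) (x r a M : R).

(** Serves for the squared positive part, whose kink at 0 escapes the usual differentiation
    rules. *)
Lemma is_derive_quadratic_remainder f x (l K : R) :
  (forall t, `|f (x + t) - f x - l * t| <= K * t ^+ 2) -> is_derive x 1 f l.
Proof.
move=> fK; suff dq : h^-1 *: (f (h *: 1%R + x) - f x) @[h --> 0^'] --> l.
  by apply: DeriveDef; [apply/cvg_ex; exists l | exact/cvg_lim].
apply/cvgrPdist_le => e e0; near=> h.
have h0 : h != 0 by near: h; exact: nbhs_dnbhs_neq.
have -> : l - h^-1 *: (f (h *: 1%R + x) - f x)
          = - (h^-1 * (f (x + h) - f x - l * h)).
  by rewrite /GRing.scale/= mulr1 [h + x]addrC; field.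
rewrite normrN normrM normfV ler_pdivrMl ?normr_gt0//.
apply: (le_trans (fK h)); rewrite -normr_id -real_normK ?num_real// normr_id.
rewrite expr2 mulrCA ler_wpM2l//.
have : `|h| <= e / (`|K| + 1).
  by near: h; apply: dnbhs0_le; rewrite divr_gt0// ltr_pwDr.
rewrite ler_pdivlMr ?ltr_pwDr// => he; apply: le_trans he.
rewrite mulrC ler_wpM2l// (le_trans (ler_norm K))//; lra.
Unshelve. all: by end_near. Qed.

Definition pos_part x : R := Num.max 0 x.

Lemma pos_partE x : pos_part x = if x <= 0 then 0 else x.
Proof. by rewrite /pos_part; case: leP. Qed.

Lemma is_derive_pos_part_sqr x :
  is_derive x 1 (fun y => pos_part y ^+ 2) (2 * pos_part x).
Proof.
(* The function is convex and its derivative is 2-Lipschitz, so the remainder lies between 0 and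
   [t ^+ 2]. *)
apply: (@is_derive_quadratic_remainder _ _ _ 1) => t; rewrite mul1r ler_norml.
by apply/andP; rewrite !pos_partE; split; do 2 case: (lerP _ 0) => ?; nra.
Qed.

Lemma continuous_pos_part : continuous pos_part.
Proof.
by move=> x; apply: (@continuous_max _ _ (cst 0) id);
  [exact: cvg_cst|exact: cvg_id].
Qed.

(** [B] is the jump across a wall, [beta] the bump, [h] and [b] their derivatives. Since [B] rises
    by exactly 1 across the collar of half-width [a], [t - B t] takes the same value at [t] and
    [t - 1] when these lie on opposite sides of the collar. *)
Record profile a M (B h beta b : R -> R) : Prop := {
  profile_derive : forall r, is_derive r 1 B (h r) ;
  profile_derive_beta : forall r, is_derive r 1 beta (b r) ;
  profile_cont : continuous h ;
  profile_cont_beta : continuous b ;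
  profile_sqr_le : forall r, h r ^+ 2 <= beta r ;
  profile_bound : forall r, [/\ `|h r| <= M, beta r <= M & `|b r| <= M] ;
  profile_right : forall r, a <= r -> B r = 2^-1 ;
  profile_left : forall r, r <= - a -> B r = - 2^-1 ;
  profile_support : forall r, a <= `|r| -> [/\ h r = 0, beta r = 0 & b r = 0] }.

Lemma unit_profile : exists B h beta b, profile 2 32 B h beta b.
Proof.
pose s (y : R) : R := pos_part y ^+ 2.
have ds (y : R) : is_derive y 1 s (2 * pos_part y) 
  by exact: is_derive_pos_part_sqr.
(* A tent of height 1 supported on [-1, 1], written as a second difference of [pos_part]. *)
pose hat (r : R) : R := pos_part (r + 1) - 2 * pos_part r + pos_part (r - 1).
have hat_bound r : 0 <= hat r <= 1.
  by rewrite /hat !pos_partE; apply/andP; do 3 case: (lerP _ 0) => ?; lra.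
have hat0 r : 1 <= `|r| -> hat r = 0.
  rewrite /hat !pos_partE; case: (ger0P r) => ? ?.
    by do 3 case: (lerP _ 0) => ?; lra.
  by do 3 case: (lerP _ 0) => ?; lra.
(* Half the second difference of [s] is a primitive of [hat] rising from 0 to 1. The bump is the
   square of the positive part of 4 - r^2: it is at least 9 on [-1, 1], where [hat] is at most 1,
   and it vanishes outside [-2, 2]. There 16 bounds the bump and 32 its derivative. *)
exists (fun r : R => - 2^-1 + 2^-1 * (s (r + 1) - 2 * s r + s (r - 1))).
exists hat.
exists (fun r => s (4 - r ^+ 2)).
exists (fun r => - (4 * r * pos_part (4 - r ^+ 2))).
split.
- move=> r.
  have d1 : is_derive r 1 (s \o (fun r : R => r + 1))
      (2 * pos_part (r + 1) * 1).
    by apply: is_derive1_comp; apply: is_derive_eq; rewrite addr0.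
  have d2 : is_derive r 1 (s \o (fun r : R => r - 1))
      (2 * pos_part (r - 1) * 1).
    by apply: is_derive1_comp; apply: is_derive_eq; rewrite subr0.
  apply: is_derive_eq; rewrite /GRing.scale/= /hat; first by field.
- move=> r.
  have d1 : is_derive r 1 (s \o (fun r : R => 4 - r ^+ 2))
      (2 * pos_part (4 - r ^+ 2) * - (2 * r)).
    apply: is_derive1_comp; apply: is_derive_eq; rewrite /GRing.scale/=; ring.
  apply: is_derive_eq; ring.
- move=> r; have cp (k : R) : pos_part (y + k) @[y --> r] --> pos_part (r + k).
    apply: (@continuous_comp _ _ _ (fun y : R => y + k) pos_part).
      by apply: cvgD; [exact: cvg_id|exact: cvg_cst].
    exact: continuous_pos_part.
  apply: cvgD; [apply: cvgB|]; [exact: cp| |exact: cp].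
  by apply: cvgM; [exact: cvg_cst|exact: continuous_pos_part].
- move=> r; apply: cvgN; apply: cvgM.
    by apply: cvgM; [exact: cvg_cst|exact: cvg_id].
  apply: (@continuous_comp _ _ _ (fun y : R => 4 - y ^+ 2) pos_part).
    by apply: cvgB; [exact: cvg_cst|apply: exprn_continuous].
  exact: continuous_pos_part.
- move=> r; rewrite /s; have /andP[h0 h1] := hat_bound r.
  have [r1|r1] := leP `|r| 1; last first.
    by rewrite hat0 ?expr0n ?sqr_ge0// ltW.
  have r2 : r ^+ 2 <= 1 by rewrite -real_normK ?num_real// expr_le1.
  by rewrite (pos_partE (4 - _)); case: (lerP _ 0) => ?; nra.
- move=> r; rewrite /s; split; rewrite ?ler_norml ?pos_partE.
  + by have /andP[? ?] := hat_bound r; apply/andP; split; lra.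
  + case: (lerP _ 0) => ?; nra.
  + case: (lerP _ 0) => r4; first by apply/andP; split; lra.
    have r2 : r <= 2 by nra.
    have r2' : -2 <= r by nra.
    by apply/andP; split; nra.
- by move=> r r2; rewrite /s !pos_partE; do 3 case: (lerP _ 0) => ?; nra.
- by move=> r r2; rewrite /s !pos_partE; do 3 case: (lerP _ 0) => ?; nra.
- move=> r r2.
  have r4 : 4 <= r ^+ 2 by rewrite -real_normK ?num_real//; nra.
  have -> : hat r = 0 by apply: hat0; lra.
  rewrite /s pos_partE.
  by case: (lerP _ 0) => ?; split=> //; nra.
Qed.

Lemma profile_exists a :
  0 < a -> exists M B h beta b, 0 < M /\ profile a M B h beta b.
Proof.
move=> a0; have [B [h [beta [b p]]]] := unit_profile.
pose c := 2 / a; have c0 : 0 < c by rewrite divr_gt0.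
have dc (r : R) : is_derive r 1 (fun r : R => c * r) c.
  by apply: is_derive_eq; rewrite /GRing.scale/= mulr1.
have cc : continuous (fun r : R => c * r).
  by move=> r; apply: cvgM; [exact: cvg_cst|exact: cvg_id].
(* Rescaling [r] by [c] multiplies [h] by [c]; the factor [c ^+ 2] on [beta] preserves the
   domination of [h ^+ 2], and its derivative gains [c ^+ 3]. The sum of the three powers bounds all
   of them. *)
exists (32 * (c + c ^+ 2 + c ^+ 3)), (B \o (fun r : R => c * r)).
exists (fun r => h (c * r) * c), (fun r : R => c ^+ 2 * beta (c * r)).
exists (fun r : R => c ^+ 2 * (b (c * r) * c)).
have c2 : 0 < c ^+ 2 by rewrite exprn_gt0.
have c3 : 0 < c ^+ 3 by rewrite exprn_gt0.
split; first by lra.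
have ca : c * a = 2 by rewrite /c divfK// gt_eqF.
clearbody c.
split.
- by move=> r; apply: is_derive1_comp; exact: (profile_derive p).
- move=> r.
  have d1 : is_derive r 1 (beta \o (fun r : R => c * r)) (b (c * r) * c).
    by apply: is_derive1_comp; exact: (profile_derive_beta p).
  by apply: is_derive_eq.
- move=> r; apply: cvgM; last exact: cvg_cst.
  by apply: (@continuous_comp _ _ _ (fun r : R => c * r) h);
    [exact: cc|exact: profile_cont p _].
- move=> r; apply: cvgM; first exact: cvg_cst.
  apply: cvgM; last exact: cvg_cst.
  by apply: (@continuous_comp _ _ _ (fun r : R => c * r) b);
    [exact: cc|exact: profile_cont_beta p _].
- move=> r; rewrite exprMn [leLHS]mulrC ler_wpM2l ?(ltW c2)//.
  exact: profile_sqr_le p _.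
- move=> r; have [p1 p2 p3] := profile_bound p (c * r).
  split.
  + rewrite normrM (gtr0_norm c0); nra.
  + nra.
  + rewrite (@normrM _ (c ^+ 2)) (@normrM _ (b _)).
    rewrite (gtr0_norm c0) (gtr0_norm c2) mulrCA -exprSr; nra.
- by move=> r ar; apply: (profile_right p); rewrite -ca ler_pM2l.
- by move=> r ar; apply: (profile_left p); rewrite -ca -mulrN ler_pM2l.
- move=> r ar; have [|-> -> ->] := @profile_support _ _ _ _ _ _ p (c * r).
    by rewrite normrM (gtr0_norm c0) -ca ler_pM2l.
  by rewrite !mul0r !mulr0.
Qed.

End Profiles.

(** * Separated test functions, and viscosity tests at extrema over boxes *)

Section Separated.
Set Implicit Arguments.
Unset Strict Implicit.
Variables (R : realType) (n : nat).
Implicit Types (x q P : 'rV[R]_n) (u : 'rV[R]_n -> R).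

(* Without this instance, [apply: cvgB] and the like fail to solve their
   [Filter] side condition at this type. *)
Global Instance nbhs_rV_filter x : Filter (nbhs x).
Proof. exact: nbhs_filter. Qed.

Lemma enorm_sqr x : enorm x ^+ 2 = \sum_i x 0 i ^+ 2.
Proof. by rewrite sqr_sqrtr// sumr_ge0// => i _; rewrite sqr_ge0. Qed.

Lemma continuous_coord_shift q i :
  continuous (fun x : 'rV[R]_n => x 0 i + q 0 i).
Proof.
by move=> x; exact: (cvgD (@coord_continuous R 1 n 0 i x) (cvg_cst (q 0 i))).
Qed.

Definition coord_sum (f : 'I_n -> R -> R) q x : R :=
  \sum_i f i (x 0 i + q 0 i).

Lemma continuous_coord_sum (f : 'I_n -> R -> R) q :
  (forall i, continuous (f i)) -> continuous (coord_sum f q).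
Proof.
move=> fc; apply: continuous_big => [|i _ x]; first exact: add_continuous.
apply: (@continuous_comp _ _ _ (fun y : 'rV[R]_n => y 0 i + q 0 i) (f i));
  last exact: fc.
exact: continuous_coord_shift.
Qed.

Lemma continuous_row (g : 'I_n -> 'rV[R]_n -> R) :
  (forall i, continuous (g i)) ->
  continuous (fun x : 'rV[R]_n => \row_i g i x : 'rV[R]_n).
Proof.
move=> cg x; suff near_le : forall e : R, 0 < e ->
    \forall y \near (x : 'rV[R]_n),
    `|\row_i g i x - \row_i g i y| <= e.
  exact: (cvgrPdist_le _ _).2 near_le.
move=> e e0; near=> y.
rewrite [leLHS]/Num.Def.normr/= mx_normrE (bigmax_le _ (ltW e0))//= => -[k i] _.
rewrite !mxE/=; move: i; near: y; apply: filter_forall => /= i.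
exact: (cvgrPdist_le _ _).1 (cg i x) e e0.
Unshelve. all: by end_near. Qed.

Lemma coord_sum_C1 (f f' : 'I_n -> R -> R) q :
  (forall i (r : R), is_derive r 1 (f i) (f' i r)) ->
  (forall i, continuous (f' i)) ->
  C1 (coord_sum f q) /\
  forall x, grad (coord_sum f q) x = \row_i f' i (x 0 i + q 0 i).
Proof.
move=> df cf'.
have dcoord x i : differentiable (fun y : 'rV[R]_n => y 0 i + q 0 i) x.
  by apply: differentiableD; [exact: differentiable_coord|
    exact: differentiable_cst].
have dfi i (r : R) : differentiable (f i) r.
  by apply/derivable1_diffP; have [] := df i r.
have dterm x i : differentiable (f i \o (fun y : 'rV[R]_n => y 0 i + q 0 i)) x.
  by apply: differentiable_comp.
have sepE : coord_sum f q = \sum_i (f i \o (fun y : 'rV[R]_n => y 0 i + q 0 i)).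
  by apply/funext => x; rewrite /coord_sum fct_sumE.
have gradE x : grad (coord_sum f q) x = \row_i f' i (x 0 i + q 0 i).
  apply/rowP => j; rewrite !mxE sepE derive_sum; last first.
    by move=> i; exact: diff_derivable.
  (* Along a basis vector the i-th summand moves with speed 1 or 0, so the two difference quotients
     are the same function. *)
  have dirE i : 'D_(delta_mx 0 j) (f i \o (fun y : 'rV[R]_n => y 0 i + q 0 i)) x
              = 'D_((i == j)%:R : R) (f i) (x 0 i + q 0 i).
    rewrite /derive; set g := (X in lim (X @ _)).
    set g' := (X in _ = lim (X @ _)).
    suff -> : g = g' by [].
    by apply/funext => h; rewrite /g /g' /= !mxE eqxx /= addrA.
  rewrite (bigD1 j)//= big1 ?addr0 => [|i /negPf ij].
    by rewrite dirE eqxx; have [_ ->] := df j (x 0 j + q 0 j).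
  by rewrite dirE ij derive0.
split=> //; split.
  by move=> x; rewrite sepE; exact: differentiable_sum.
rewrite (_ : grad _ = fun x => \row_i f' i (x 0 i + q 0 i)); last exact/funext.
apply: continuous_row => i x.
apply: (@continuous_comp _ _ _ (fun y : 'rV[R]_n => y 0 i + q 0 i) (f' i));
  last exact: cf'.
exact: continuous_coord_shift.
Qed.

(** For [r] equal to 1/2 this is a closed fundamental domain of the torus, with the walls through
    its centre and its faces far from them; with [- x0] for [q] it is a neighbourhood of [x0]. *)
Definition box q (r : R) : set 'rV[R]_n :=
  [set x | forall i, `|x 0 i + q 0 i| <= r].

Lemma box_compact q (r : R) : compact (box q r).
Proof.
pose I i : set R := `[- r - q 0 i, r - q 0 i]%classic.
have -> : box q r = [set x : 'rV[R]_n | forall i, I i (x ord0 i)].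
  apply/seteqP; split=> x /= H i; have := H i;
    rewrite /I /= in_itv/= ler_norml => /andP[? ?]; apply/andP; split; lra.
by apply: rV_compact => i; exact: segment_compact.
Qed.

Lemma box_nbhs q (r : R) x : (forall i, `|x 0 i + q 0 i| < r) ->
  \forall y \near x, box q r y.
Proof.
move=> xr; suff xi i : nbhs x [set y : 'rV[R]_n | `|y 0 i + q 0 i| <= r].
  exact: (@filter_forall _ _ _ (nbhs x) _ xi).
have cn : continuous (fun y : 'rV[R]_n => `|y 0 i + q 0 i|).
  by move=> y; exact: (cvg_norm (@continuous_coord_shift q i y)).
apply: (@filterS _ (nbhs x) _
  [set y : 'rV[R]_n | `|y 0 i + q 0 i| < r]) => [y|].
  exact: ltW.
exact: (cvgr_lt _ (cn x) _ (xr i)).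
Qed.

(** No smooth function need touch [u] from above at a given point. If [G] is positive at [x0], hence
    on a small box, a steep paraboloid centred at [x0] touches [u] somewhere inside that box, and
    the test there contradicts [G <= F] whatever the gradient is. *)
Lemma visc_subsol_le0 (F : 'rV[R]_n -> 'rV[R]_n -> R) (G u : 'rV[R]_n -> R) :
  continuous u -> continuous G -> visc_subsol F u ->
  (forall x p, G x <= F x p) -> forall x, G x <= 0.
Proof.
move=> cu cG Fu GF x0; rewrite leNgt; apply/negP => G0.
have [e e0 eG] : exists2 e : R, 0 < e &
    forall y, box (- x0) e y -> 0 < G y.
  have : \forall y \near x0, 0 < G y by exact: (cvgr_gt _ (cG x0)).
  move=> /(nbhs_ballP x0) [e /= e0 eG];
  exists (e / 2); first by rewrite divr_gt0.
  move=> y ye; apply: eG; split=> // k i; rewrite (ord1 k) /ball/= distrC.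
  by have := ye i; rewrite mxE => /le_lt_trans; apply; lra.
pose K := box (- x0) e.
have Kx0 : K x0 by move=> i; rewrite mxE subrr normr0 ltW.
have Kc : compact K by exact: box_compact.
have K0 : K !=set0 by exists x0.
have [m _ mU] := compact_EVT_max K0 Kc (continuous_subspaceT cu).
(* On the faces of the box the penalty is at least [u m - u x0 + 1], so the penalised value is at
   most [u x0 - 1], below its value at the centre: the maximum is interior. *)
pose k := (u m - u x0 + 1) / e ^+ 2.
have umx0 : u x0 <= u m by apply: mU; rewrite inE.
have k0 : 0 <= k by rewrite /k divr_ge0 ?sqr_ge0//; lra.
pose f (_ : 'I_n) (t : R) := k * t ^+ 2.
pose f' (_ : 'I_n) (t : R) := k * (2 * t).
have df i (r : R) : is_derive r 1 (f i) (f' i r).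
  by apply: is_derive_eq; rewrite /GRing.scale/= /f'; ring.
have cf' i : continuous (f' i).
  move=> r; apply: cvgM; first exact: cvg_cst.
  by apply: cvgM; [exact: cvg_cst|exact: cvg_id].
have [f_C1 _] := coord_sum_C1 (- x0) df cf'.
have cf : continuous (fun y => u y - coord_sum f (- x0) y).
  move=> y; apply: cvgB; [exact: cu|].
  by apply: continuous_coord_sum => i r; apply: cvgM;
    [exact: cvg_cst|exact: exprn_continuous].
have [y Ky yM] := compact_EVT_max K0 Kc (continuous_subspaceT cf).
have {}Ky : K y by rewrite inE in Ky.
have := GF y (grad (coord_sum f (- x0)) y); apply/negP; rewrite -ltNge.
apply: (le_lt_trans _ (eG y Ky)); apply: Fu => //.
have ye : forall i, `|y 0 i + (- x0) 0 i| < e.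
  move=> i; rewrite ltNge; apply/negP => ey.
  have : u x0 <= u y - coord_sum f (- x0) y.
    apply: le_trans (yM x0 _); last by rewrite inE.
    rewrite /coord_sum big1 ?subr0// => j _.
    by rewrite /f mxE subrr expr0n/=; exact: mulr0.
  have : u y <= u m by apply: mU; rewrite inE.
  suff : u m - u x0 + 1 <= coord_sum f (- x0) y by lra.
  rewrite /coord_sum (bigD1 i)//= -[leLHS]addr0 lerD//; last first.
    by apply: sumr_ge0 => j _; rewrite mulr_ge0// sqr_ge0.
  have -> : u m - u x0 + 1 = k * e ^+ 2.
    by rewrite /k divfK// expf_neq0// gt_eqF.
  by rewrite /f ler_wpM2l// -[leRHS]real_normK ?num_real// lerXn2r// nnegrE ltW.
apply: (@filterS _ (nbhs y) _ _ _ _ (box_nbhs ye)) => z Kz.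
by apply: yM; rewrite inE.
Qed.

(** The minimum may sit on a face of the box, so the faces must be glued. A point of the box of
    half-width 3/4 is folded back by an integer translation, which changes neither [u] nor the sum;
    the [f i] need only match near the faces. *)
Lemma coord_sum_local_min u (f : 'I_n -> R -> R) q x :
  Zn_periodic u ->
  (forall i t, 4^-1 <= t <= 3 / 4 -> f i (t - 1) = f i t) ->
  box q 2^-1 x ->
  (forall y, box q 2^-1 y ->
     u x - coord_sum f q x <= u y - coord_sum f q y) ->
  \forall y \near x, u x - coord_sum f q x <= u y - coord_sum f q y.
Proof.
move=> up fp xq xmin.
have xq' : forall i, `|x 0 i + q 0 i| < 3 / 4.
  by move=> i; apply: le_lt_trans (xq i) _; lra.
apply: (@filterS _ (nbhs x) _ _ _ _ (box_nbhs xq')) => y yq.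
pose t i := y 0 i + q 0 i.
pose z : 'rV[int]_n := \row_i
  (if 2^-1 < t i then -1 else if t i < - 2^-1 then 1 else 0).
have tE i : t i = y 0 i + q 0 i by [].
have -> : u y - coord_sum f q y
    = u (y + map_mx intr z) - coord_sum f q (y + map_mx intr z).
  rewrite up; congr (_ - _); apply: eq_bigr => i _; rewrite !mxE addrAC -tE.
  have := yq i; rewrite ler_norml -tE => /andP[t1 t2].
  case: ltP => ti; first by rewrite [(-1)%:~R]mulrN1z fp//; lra.
  case: ltP => ti'; last by rewrite addr0.
  by rewrite -[in LHS](addrK 1 (t i)) fp//; lra.
apply: xmin => i; rewrite !mxE addrAC -tE.
have := yq i; rewrite !ler_norml -tE => /andP[t1 t2].
case: ltP => ti; first by rewrite [(-1)%:~R]mulrN1z; lra.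
case: ltP => ti'; last by rewrite addr0; lra.
by lra.
Qed.

End Separated.

(** * Positivity of the potential near the walls, and the two bounds on the cell constant *)

Section Main.
Set Implicit Arguments.
Unset Strict Implicit.
Variables (R : realType) (n : nat).
Implicit Types (x q P : 'rV[R]_n) (V u : 'rV[R]_n -> R).

Lemma pos_on_hyperplanes V q (W : set 'rV[R]_n) x i :
  Zn_periodic V ->
  compactly_contained (torus_proj [set q + y | y in W]) (@open_cube R n) ->
  [set y | V y = 0] `<=` W -> (forall y, 0 <= V y) ->
  x 0 i + q 0 i = 0 -> 0 < V x.
Proof.
move=> Vp [_ Wcube] VW V0 xi; rewrite lt_neqAle V0 andbT; apply/eqP => Vx0.
have Wx : W x by apply: VW.
(* The fractional part of x + q represents a point of the projected set, so it must lie in the open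
   cube, yet its i-th coordinate is 0. *)
pose z : 'rV[int]_n := \row_j Num.floor (x 0 j + q 0 j).
pose y : 'rV[R]_n := \row_j (x 0 j + q 0 j - (z 0 j)%:~R).
have : (@open_cube R n) y.
  apply: Wcube; apply: subset_closure; split.
    move=> j; rewrite !mxE subr_ge0 floor_le_tmp/=.
    by have := ltW (floorD1_gt (x 0 j + q 0 j)); rewrite intrD; lra.
  exists z; exists x => //; apply/rowP => j; rewrite !mxE subrK addrC.
  by [].
by move=> /(_ i); rewrite !mxE xi floor0 subrr ltxx.
Qed.

(** On the compact box V + |y_i| has a positive minimum m, so V >= m - d >= d where |y_i| <= d <= m
    / 2. One [d] thus serves as collar width and as lower bound; [d <= 4^-1] keeps the collar away
    from the glued faces. *)
Lemma pos_near_hyperplanes V q :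
  continuous V -> (forall x, 0 <= V x) ->
  (forall x i, x 0 i + q 0 i = 0 -> 0 < V x) ->
  exists2 d : R, 0 < d <= 4^-1 &
    forall x i, box q 2^-1 x -> `|x 0 i + q 0 i| <= d -> d <= V x.
Proof.
move=> cV V0 Vpos.
have /filter_ex[d [d0 d4 dV]] : \forall d \near (0:R)^'+, [/\ 0 < d, d <= 4^-1 &
    forall i x, box q 2^-1 x -> `|x 0 i + q 0 i| <= d -> d <= V x].
  near=> d; split.
  - by near: d; exact: nbhs_right_gt.
  - by near: d; apply: nbhs_right_le; rewrite invr_gt0.
  - near: d; apply: filter_forall => i.
    have cG : continuous (fun x => V x + `|x 0 i + q 0 i|).
      move=> x; apply: cvgD; first exact: cV.
      exact: (cvg_norm (@continuous_coord_shift _ _ q i x)).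
    have box0 : box q 2^-1 !=set0.
      by exists (- q) => j; rewrite !mxE addNr normr0 invr_ge0.
    have [m _ mG] := compact_EVT_min box0 (@box_compact _ _ q 2^-1)
      (continuous_subspaceT cG).
    have Gm0 : 0 < V m + `|m 0 i + q 0 i|.
      have [/Vpos Vm|m0] := eqVneq (m 0 i + q 0 i) 0; first by rewrite ltr_pwDl.
      by rewrite ltr_wpDl// normr_gt0.
    near=> d => x xb xd.
    have := mG x; rewrite inE => /(_ xb).
    have : d <= (V m + `|m 0 i + q 0 i|) / 2.
      by near: d; apply: nbhs_right_le; rewrite divr_gt0.
    lra.
by exists d => [|x i]; [rewrite d0 d4|exact: dV].
Unshelve. all: by end_near. Qed.

Variables (V1 V2 : 'rV[R]_n -> R).

(** Dropping the squared gradient leaves bounds free of [p]; at [x0] the two resulting inequalities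
    add up to -2c <= 0. *)
Lemma cell_constant_ge0 P (c : R) v1 v2 x0 :
  continuous V2 -> (forall x, V1 x = 0) -> V2 x0 = 0 ->
  cell_solution (mech_hamiltonian V1) (mech_hamiltonian V2) P c v1 v2 ->
  0 <= c.
Proof.
move=> cV2 V10 V20 [[_ cv1] [_ cv2] [sub1 _] [sub2 _]].
have le1 : v1 x0 - v2 x0 - c <= 0.
  apply: (visc_subsol_le0 (G := fun x => v1 x - v2 x - c) cv1 _ sub1).
    move=> x; apply: cvgB; last exact: cvg_cst.
    by apply: cvgB; [exact: cv1|exact: cv2].
  move=> x p; rewrite /mech_hamiltonian V10.
  by have := sqr_ge0 (enorm (P + p)); lra.
have le2 : - V2 x0 + v2 x0 - v1 x0 - c <= 0.
  apply: (visc_subsol_le0 (G := fun x => - V2 x + v2 x - v1 x - c) cv2 _ sub2).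
    move=> x; apply: cvgB; [apply: cvgB; [apply: cvgD|]|exact: cvg_cst].
    - by apply: cvgN; exact: cV2.
    - exact: cv2.
    - exact: cv1.
  move=> x p; rewrite /mech_hamiltonian.
  by have := sqr_ge0 (enorm (P + p)); lra.
lra.
Qed.

(** The bound on [V2] is the second subsolution inequality for (w1, w2) with constant 0; the first
    one is [profile_sqr_le]. *)
Lemma cell_constant_le0 P (c a M : R) q B h beta b v1 v2 :
  (forall x, V1 x = 0) -> a <= 4^-1 -> profile a M B h beta b ->
  (forall x, box q 2^-1 x ->
     \sum_i ((P 0 i * h (x 0 i + q 0 i) + P 0 i ^+ 2 * b (x 0 i + q 0 i)) ^+ 2
             + P 0 i ^+ 2 * beta (x 0 i + q 0 i)) <= V2 x) ->
  cell_solution (mech_hamiltonian V1) (mech_hamiltonian V2) P c v1 v2 ->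
  c <= 0.
Proof.
move=> V10 a4 p Vge [[v1p cv1] [v2p cv2] [_ sup1] [_ sup2]].
pose f1 i t := - (P 0 i * (t - B t)).
pose f1' i t := P 0 i * h t - P 0 i.
pose f2 i t := f1 i t + P 0 i ^+ 2 * beta t.
pose f2' i t := f1' i t + P 0 i ^+ 2 * b t.
have df1 i (r : R) : is_derive r 1 (f1 i) (f1' i r).
  have dB := profile_derive p r.
  by apply: is_derive_eq; rewrite /GRing.scale/= /f1'; ring.
have df2 i (r : R) : is_derive r 1 (f2 i) (f2' i r).
  have db := profile_derive_beta p r.
  by apply: is_derive_eq.
have cf1' i : continuous (f1' i).
  move=> r; apply: cvgB; last exact: cvg_cst.
  by apply: cvgM; [exact: cvg_cst|exact: profile_cont p _].
have cf2' i : continuous (f2' i).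
  move=> r; apply: cvgD; first exact: cf1'.
  by apply: cvgM; [exact: cvg_cst|exact: profile_cont_beta p _].
have contf (f f' : 'I_n -> R -> R) :
    (forall i (r : R), is_derive r 1 (f i) (f' i r)) ->
    forall i, continuous (f i).
  move=> df i r; apply: differentiable_continuous.
  by apply/derivable1_diffP; have [] := df i r.
(* As [a <= 4^-1], the points [t] and [t - 1] lie on opposite sides of the collar. *)
have perB t : 4^-1 <= t <= 3 / 4 -> B (t - 1) = B t - 1.
  by move=> ?; rewrite (profile_left p) ?(profile_right p); lra.
have per1 i t : 4^-1 <= t <= 3 / 4 -> f1 i (t - 1) = f1 i t.
  by move=> t4; rewrite /f1 perB//; congr (- (_ * _)); ring.
have per2 i t : 4^-1 <= t <= 3 / 4 -> f2 i (t - 1) = f2 i t.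
  move=> t4; rewrite /f2 per1//; congr (_ + _ * _).
  have [|_ -> _] := profile_support p (r := t - 1).
    by rewrite ler0_norm; lra.
  have [|_ -> _] := profile_support p (r := t) => //.
  by rewrite ger0_norm; lra.
have [C1f1 gradf1] := coord_sum_C1 q df1 cf1'.
have [C1f2 gradf2] := coord_sum_C1 q df2 cf2'.
have exmin u (f : 'I_n -> R -> R) :
    continuous u -> (forall i, continuous (f i)) ->
    exists2 x, box q 2^-1 x & forall y, box q 2^-1 y ->
      u x - coord_sum f q x <= u y - coord_sum f q y.
  move=> cu cf.
  have cuf : continuous (fun x => u x - coord_sum f q x).
    by move=> x; apply: cvgB; [exact: cu|exact: continuous_coord_sum].
  have box0 : box q 2^-1 !=set0.
    by exists (- q) => j; rewrite !mxE addNr normr0 invr_ge0.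
  have [x] := compact_EVT_min box0 (@box_compact _ _ q 2^-1)
    (continuous_subspaceT cuf).
  rewrite inE => xb xmin; exists x => // y yb; apply: xmin; exact/mem_set.
have [x1 b1 m1] := exmin v1 f1 cv1 (contf _ _ df1).
have [x2 b2 m2] := exmin v2 f2 cv2 (contf _ _ df2).
have sepB x : coord_sum f2 q x = coord_sum f1 q x
    + \sum_i P 0 i ^+ 2 * beta (x 0 i + q 0 i).
  by rewrite /coord_sum -big_split.
(* The component with the smaller minimum is tested. At its minimum point, comparison with the other
   component bounds the difference of the v's by that of the w's, which is plus or minus the bump
   sum. *)
have [m12|m21] := leP (v1 x1 - coord_sum f1 q x1) (v2 x2 - coord_sum f2 q x2).
  have := sup1 _ _ C1f1 (coord_sum_local_min v1p per1 b1 m1).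
  rewrite gradf1 /mech_hamiltonian V10 enorm_sqr.
  have := le_trans m12 (m2 _ b1); rewrite sepB.
  suff : \sum_i (P + \row_i f1' i (x1 0 i + q 0 i)) 0 i ^+ 2
      <= \sum_i P 0 i ^+ 2 * beta (x1 0 i + q 0 i) by lra.
  apply: ler_sum => i _; rewrite !mxE /f1' addrC subrK exprMn.
  by rewrite ler_wpM2l ?sqr_ge0//; exact: profile_sqr_le p _.
have := sup2 _ _ C1f2 (coord_sum_local_min v2p per2 b2 m2).
rewrite gradf2 /mech_hamiltonian enorm_sqr.
have := le_trans (ltW m21) (m1 _ b2); rewrite sepB.
have := Vge _ b2; rewrite big_split/=.
suff -> : \sum_i (P + \row_i f2' i (x2 0 i + q 0 i)) 0 i ^+ 2
  = \sum_i (P 0 i * h (x2 0 i + q 0 i) + P 0 i ^+ 2 * b (x2 0 i + q 0 i)) ^+ 2.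
  by lra.
by apply: eq_bigr => i _; rewrite !mxE /f2' /f1'; congr (_ ^+ 2); ring.
Qed.

End Main.

(** * Choice of the threshold for |P| *)

Theorem theorem4p18 (R : realType) (n : nat) (n_gt0 : (0 < n)%N)
    (V1 V2 : 'rV[R]_n -> R)
    (V1_cont : torus_continuous V1) (V2_cont : torus_continuous V2)
    (Hbar : 'rV[R]_n -> R)
    (Hbar_eff : effective_hamiltonian
       (mech_hamiltonian V1) (mech_hamiltonian V2) Hbar)
    (V1_eq0 : forall x, V1 x = 0) (V2_ge0 : forall x, 0 <= V2 x)
    (hW : exists (W : set 'rV[R]_n) (q : 'rV[R]_n),
       [/\ torus_open W,
           compactly_contained (torus_proj [set q + x | x in W])
             (open_cube (R:=R) (n:=n)),
           [set x | V2 x = 0] !=set0 &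
           [set x | V2 x = 0] `<=` W]) :
  exists2 gamma : R, 0 < gamma &
    forall P : 'rV[R]_n, enorm P <= gamma -> Hbar P = 0.
Proof.
have [W [q [_ Wcube [x0 V2x0] VW]]] := hW.
have [V2p cV2] := V2_cont.
have [a /andP[a0 a4] aV] := pos_near_hyperplanes cV2 V2_ge0
  (fun x i => pos_on_hyperplanes V2p Wcube VW V2_ge0).
have [M [B [h [beta [b [M0 p]]]]]] := profile_exists a0.
(* For |P_j| <= 1 the j-th term is at most P_j^2 ((2M)^2 + M), so the whole sum is at most C |P|^2.
   With |P| <= 1 and C |P| <= a this is at most [a], the lower bound of [V2] on the collars. *)
pose C := 4 * M ^+ 2 + M.
have C0 : 0 < C by rewrite /C; nra.
exists (Num.min 1 (a / C)); first by rewrite lt_min ltr01 divr_gt0.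
move=> P; rewrite le_min ler_pdivlMr// => /andP[P1 PC].
have [[v1 [v2 sol]] _] := Hbar_eff P.
apply/eqP; rewrite eq_le (cell_constant_ge0 cV2 V1_eq0 V2x0 sol) andbT.
apply: (cell_constant_le0 (q := q) V1_eq0 a4 p _ sol) => x xb.
(* Away from all walls the profiles vanish and only [0 <= V2 x] remains. *)
have [/existsP[i xi]|/existsPn far] := boolP [exists i, `|x 0 i + q 0 i| <= a];
    last first.
  rewrite big1 ?V2_ge0// => i _.
  have [|-> -> ->] := profile_support p (r := x 0 i + q 0 i).
    by rewrite ltW// ltNge far.
  by rewrite !mulr0 !addr0 expr0n.
apply: le_trans (aV x i xb xi).
have P0 : 0 <= enorm P by exact: sqrtr_ge0.
apply: (@le_trans _ _ (C * enorm P ^+ 2)); last by nra.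
rewrite enorm_sqr mulr_sumr; apply: ler_sum => j _.
have [hM bM bM'] := profile_bound p (x 0 j + q 0 j).
have Pj1 : P 0 j ^+ 2 <= 1.
  apply: (@le_trans _ _ (enorm P ^+ 2)); last by rewrite expr_le1.
  rewrite enorm_sqr (bigD1 j)//= lerDl sumr_ge0// => k _; exact: sqr_ge0.
rewrite /C mulrDl; apply: lerD; last by rewrite mulrC ler_wpM2r// sqr_ge0.
have -> : P 0 j * h (x 0 j + q 0 j) + P 0 j ^+ 2 * b (x 0 j + q 0 j)
  = P 0 j * (h (x 0 j + q 0 j) + P 0 j * b (x 0 j + q 0 j)) by ring.
rewrite exprMn mulrC ler_wpM2r ?sqr_ge0//.
have -> : 4 * M ^+ 2 = (M + M) ^+ 2 by ring.
rewrite -real_normK ?num_real// lerXn2r ?nnegrE ?addr_ge0 ?(ltW M0)//.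
apply: le_trans (ler_normD _ _) _; apply: lerD => //.
rewrite normrM; apply: le_trans bM'; rewrite ler_piMl//.
by rewrite -(@expr_le1 _ 2)// real_normK ?num_real.
Qed.
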